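(* Let $m,n\in\mathbb{N}$ with $m\ge 2$ and $n\ge 2$. Consider the decomposition of $Z_n^m$ into orbits with respect to the action $(A,a)\mapsto aA \pmod n$ of the group $SL(m,Z_n)$. Then: (i) any orbit is equal to the orbit $\mathrm{Or}_{m,n}(d)$ for some divisor $d$ of $n$, i.e. $$Z_n^m=\bigcup_{d\mid n}\mathrm{Or}_{m,n}(d);$$ (ii) for every divisor $d$ of $n$, $\mathrm{Or}_{m,n}(d)=\{a\in Z_n^m \mid \gcd(a,n)=d\}$; (iii) for every divisor $d$ of $n$, the number of points in $\mathrm{Or}_{m,n}(d)$ is given by the Jordan function: $$|\mathrm{Or}_{m,n}(d)|=\varphi_m\left(\frac{n}{d}\right)=\left(\frac{n}{d}\right)^m\prod_{p\ \text{prime},\ pd\mid n}\left(1-p^{-m}\right).$$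
   Context: $\mathbb{N}=\{1,2,3,\ldots\}$, and divisors are positive. $Z_n=\{0,1,\ldots,n-1\}$ is the ring of integers modulo $n$; $Z_n^m$ is the $m$-fold Cartesian product, whose elements are regarded as row vectors. $SL(m,Z_n)$ is the group of $m\times m$ matrices over $Z_n$ with determinant $1 \pmod n$, under matrix multiplication modulo $n$. It acts on $Z_n^m$ by right multiplication of row vectors: $A\in SL(m,Z_n)$ sends $a\in Z_n^m$ to $aA$ (reduced mod $n$). The orbits are the classes of the equivalence $a\sim b \Leftrightarrow \exists A\in SL(m,Z_n),\ aA=b$. For a divisor $d$ of $n$, $\mathrm{Or}_{m,n}(d)=\{a\in Z_n^m\mid a\sim(0,\ldots,0,(d)_{\mathrm{mod}\ n})\}$ (so $\mathrm{Or}_{m,n}(n)$ is the orbit of the zero vector). For $a=(a_1,\ldots,a_m)\in Z_n^m$, $\gcd(a,n):=\gcd(a_1,\ldots,a_m,n)$ is the greatest common divisor in the integers of the representatives $a_i\in\{0,\ldots,n-1\}$ and $n$. The Jordan function of order $m$ is $\varphi_m:\mathbb{N}\to\mathbb{N}$, $\varphi_m(k)=|\{a\in Z_k^m\mid \gcd(a,k)=1\}|$ (with $Z_1=\{0\}$, so $\varphi_m(1)=1$). *)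

(* Defs.v *)
From HB Require Import structures.
From mathcomp Require Import all_boot all_algebra fingroup action.

Set Implicit Arguments.
Unset Strict Implicit.
Unset Printing Implicit Defensive.

Import GRing.Theory.
Local Open Scope ring_scope.

Section SpecialLinear.

Variables (m : nat) (R : finComNzRingType).

Record SL : predArgType :=
  MkSL { SLval :> 'M[R]_m; SLvalP : \det SLval == 1 }.

HB.instance Definition _ := [isSub for SLval].
HB.instance Definition _ := [Finite of SL by <:].

Fact SL_one_subproof : \det (1%:M : 'M[R]_m) == 1.
Proof. by rewrite det1. Qed.

Fact SL_mul_subproof (A B : SL) : \det (A *m B) == 1.
Proof. by rewrite det_mulmx (eqP (SLvalP A)) (eqP (SLvalP B)) mulr1. Qed.

(* For determinant 1 the adjugate is the inverse. *)
Fact SL_inv_subproof (A : SL) : \det (\adj A) == 1.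
Proof.
have := congr1 determinant (mul_mx_adj A).
by rewrite det_mulmx (eqP (SLvalP A)) mul1r det1 => ->.
Qed.

Definition SL_one : SL := MkSL SL_one_subproof.
Definition SL_mul (A B : SL) : SL := MkSL (SL_mul_subproof A B).
Definition SL_inv (A : SL) : SL := MkSL (SL_inv_subproof A).

Fact SL_mulA : associative SL_mul.
Proof. by move=> A B C; apply: val_inj; rewrite /= mulmxA. Qed.

Fact SL_mul1 : left_id SL_one SL_mul.
Proof. by move=> A; apply: val_inj; rewrite /= mul1mx. Qed.

Fact SL_mulV : left_inverse SL_one SL_inv SL_mul.
Proof.
by move=> A; apply: val_inj; rewrite /= mul_adj_mx (eqP (SLvalP A)).
Qed.

HB.instance Definition _ := Finite_isGroup.Build SL SL_mulA SL_mul1 SL_mulV.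

Definition SLact (a : 'rV[R]_m) (A : SL) : 'rV[R]_m := a *m SLval A.

Fact SLact1 : SLact^~ 1%g =1 id.
Proof. by move=> a; apply: mulmx1. Qed.

Fact SLactM a : act_morph SLact a.
Proof. by move=> A B; apply: mulmxA. Qed.

Canonical SL_action := TotalAction SLact1 SLactM.

End SpecialLinear.

Definition last_row (R : pzRingType) (m : nat) (c : R) : 'rV[R]_m :=
  \row_(j < m) (if j.+1 == m then c else 0).

(* 'Z_n is Z/nZ only for 1 < n. *)
Definition Or (m n d : nat) : {set 'rV['Z_n]_m} :=
  [set a | last_row m (d%:R : 'Z_n)
             \in orbit (SL_action m 'Z_n) [set: SL m 'Z_n] a].

(* The modulus k is a separate argument because 'Z_n is 'I_N for an N that is
   only provably equal to n. *)
Definition gcd_row (m N : nat) (a : 'rV['I_N]_m) (k : nat) : nat :=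
  gcdn (\big[gcdn/0%N]_(j < m) a ord0 j) k.

(* Residues modulo k are taken in 'I_k rather than 'Z_k, so that the case k = 1
   is the trivial ring. *)
Definition jordan (m k : nat) : nat :=
  #|[set a : 'rV['I_k]_m | gcd_row a k == 1%N]|.

(* Main.v *)
Require Import Defs.
From mathcomp Require Import all_boot all_algebra fingroup action.

(** The gcd of a row with n is the only invariant of the action, and everything
    else follows from this.

    It is invariant because a divisor d of n divides every entry of a exactly
    when a = d b for some row b over Z/n, and then a A = d (b A); applying this
    to A and to its inverse gives equality of the gcds ([gcd_row_orbit]).

    It is complete because every row can be moved to (0, ..., 0, g) with g
    dividing n ([orbit_last_row]); by invariance this g is the gcd.  Over the
    integers, the Smith form of a one-row matrix moves a lift of the row to
    (c, 0, ..., 0).  Since m >= 2, the determinant can be corrected in a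
    coordinate where this row vanishes, and a last coordinate different from
    the first is available, so two transvections with coefficients given by a
    Bezout relation u c + v n = g turn (c, 0, ..., 0) into (c, 0, ..., 0, g)
    and then into (0, ..., 0, g).

    For the counting, write n = d k.  Multiplication by d is a bijection from
    the rows modulo k onto the rows modulo n that d divides, and it multiplies
    the gcd by d; hence the orbit of d has as many points as there are rows of
    gcd 1 modulo k ([card_gcd_row]).  The same bijection gives the product
    formula by a sieve.  A row has gcd 1 with k when no prime factor of k
    divides it.  Among the rows modulo k that avoid the primes in s, those
    divisible by a further prime p of k correspond to the rows modulo k / p
    that avoid s, which are p^m times fewer; so each prime contributes a
    factor 1 - p^-m ([card_rows_avoiding]). *)

Set Implicit Arguments.
Unset Strict Implicit.

Import GRing.Theory.
Local Open Scope ring_scope.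

(** * Divisibility of rows and the gcd *)

Lemma dvdn_gcd_row m N (a : 'rV['I_N]_m) k d :
  (d %| gcd_row a k)%N = [forall j, d %| a ord0 j]%N && (d %| k)%N.
Proof.
rewrite /gcd_row dvdn_gcd; congr andb.
by apply/dvdn_biggcdP/forallP => h j; [apply: h | move=> _; apply: h].
Qed.

Lemma dvdn_Zp n d (x : 'Z_n) : (1 < n)%N -> (d %| n)%N ->
  (d %| x)%N <-> exists y : 'Z_n, x = d%:R * y.
Proof.
move=> n_gt1 dvd_dn; split=> [/dvdnP[q def_x] | [y ->]].
  by exists q%:R; rewrite -natrM mulnC -def_x natr_Zp.
rewrite -[y]natr_Zp -natrM val_Zp_nat // /dvdn modn_dvdm //.
by rewrite modnMr.
Qed.

(** A submodule d (Z/n)^m is visibly stable under right multiplication by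
    matrices, which divisibility of representatives is not. *)
Lemma dvdn_row_Zp m n d (a : 'rV['Z_n]_m) : (1 < n)%N -> (d %| n)%N ->
  [forall j, d %| a ord0 j]%N <-> exists b : 'rV['Z_n]_m, a = d%:R *: b.
Proof.
move=> n_gt1 dvd_dn; split=> [/forallP dvd_da | [b ->]]; last first.
  by apply/forallP=> j; apply/(@dvdn_Zp n) => //; exists (b 0 j); rewrite mxE.
have quo j : exists y : 'Z_n, a ord0 j == d%:R * y.
  by have /(@dvdn_Zp n)[// | // | y ->] := dvd_da j; exists y.
exists (\row_j xchoose (quo j)); apply/rowP=> j.
by rewrite !mxE; apply/eqP/(xchooseP (quo j)).
Qed.

Lemma gcd_row_mulmx m n (a : 'rV['Z_n]_m) (A : 'M['Z_n]_m) : (1 < n)%N ->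
  (gcd_row a n %| gcd_row (a *m A) n)%N.
Proof.
move=> n_gt1; have := dvdnn (gcd_row a n); rewrite dvdn_gcd_row.
case/andP=> dvd_a dvd_n; rewrite dvdn_gcd_row dvd_n andbT.
apply/(dvdn_row_Zp _ n_gt1 dvd_n).
have [b {1}->] := (dvdn_row_Zp _ n_gt1 dvd_n).1 dvd_a.
by exists (b *m A); rewrite scalemxAl.
Qed.

Lemma gcd_row_orbit m n (a b : 'rV['Z_n]_m) : (1 < n)%N ->
  b \in orbit (SL_action m 'Z_n) [set: SL m 'Z_n] a ->
  gcd_row b n = gcd_row a n.
Proof.
move=> n_gt1 /orbitP[A _ <-]; apply/eqP.
rewrite eqn_dvd gcd_row_mulmx // andbT.
by rewrite -{2}(actK (SL_action m 'Z_n) A a) gcd_row_mulmx.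
Qed.

Lemma gcd_row_last m n d : (0 < m)%N -> (1 < n)%N -> (d %| n)%N ->
  gcd_row (last_row m (d%:R : 'Z_n)) n = d.
Proof.
case: m => // m _ n_gt1 dvd_dn; apply/eqP; rewrite eqn_dvd; apply/andP; split.
  have := dvdnn (gcd_row (last_row m.+1 (d%:R : 'Z_n)) n).
  rewrite {2}/gcd_row; set g := gcd_row _ _; rewrite dvdn_gcd => /andP[+ dvd_gn].
  move/dvdn_biggcdP/(_ ord_max isT); rewrite mxE eqxx val_Zp_nat //.
  by rewrite /dvdn modn_dvdm.
rewrite dvdn_gcd_row dvd_dn andbT; apply/dvdn_row_Zp => //.
exists (last_row _ 1); apply/rowP=> j; rewrite !mxE.
by case: ifP; rewrite ?mulr1 ?mulr0.
Qed.

(** * Reduction of a row to the form (0, ..., 0, g) *)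

Definition transvection (R : comNzRingType) m (i j : 'I_m) (c : R) : 'M[R]_m :=
  1%:M + c *: delta_mx i j.

(** Transposition exchanges the indices, which reduces the claim to a lower
    triangular matrix with unit diagonal. *)
Lemma det_transvection (R : comNzRingType) m (i j : 'I_m) (c : R) :
  i != j -> \det (transvection i j c) = 1.
Proof.
wlog lt_ji : i j / (j < i)%N => [IH | _].
  case: (ltngtP j i) => [lt_ji | lt_ij | /val_inj->]; last by rewrite eqxx.
    exact: IH.
  rewrite eq_sym => neq_ij; rewrite -(IH j i) // -det_tr.
  by rewrite /transvection linearD linearZ /= trmx1 trmx_delta.
rewrite det_trig.
  rewrite big1 // => k _; rewrite !mxE eqxx /=.
  case: eqP => [-> | _]; last by rewrite mulr0 addr0.
  by rewrite (gtn_eqF lt_ji : i == j = false) mulr0 addr0.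
apply/is_trig_mxP=> k l lt_kl; rewrite !mxE.
rewrite (ltn_eqF lt_kl : k == l = false) add0r.
case: eqP => [def_k | _]; last by rewrite mulr0.
case: eqP => [def_l | _]; last by rewrite mulr0.
by move: lt_kl; rewrite def_k def_l ltnNge ltnW.
Qed.

Lemma delta_transvection (R : comNzRingType) m (i j : 'I_m) (c : R) :
  delta_mx (0 : 'I_1) i *m transvection i j c
    = delta_mx 0 i + c *: delta_mx 0 j.
Proof. by rewrite mulmxDr mulmx1 -scalemxAr mul_delta_mx. Qed.

Lemma delta_transvection_neq (R : comNzRingType) m (i j k : 'I_m) (c : R) :
  k != i -> delta_mx (0 : 'I_1) k *m transvection i j c = delta_mx 0 k.
Proof.
move=> neq_ki.
by rewrite mulmxDr mulmx1 -scalemxAr mul_delta_mx_0 // scaler0 addr0.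
Qed.

(** Scaling the last coordinate by the inverse of det A corrects the
    determinant, and with at least two coordinates it does not touch the
    first basis vector. *)
Lemma unitmx_correct_det (R : comUnitRingType) m (A : 'M[R]_m.+2) : A \in unitmx ->
  exists B : 'M[R]_m.+2, \det (A *m B) = 1 /\
    delta_mx 0 0 *m B = delta_mx 0 0 :> 'rV[R]_m.+2.
Proof.
move=> uA.
pose e := \row_(j < m.+2) if j == ord_max then (\det A)^-1 else 1.
exists (diag_mx e); split.
  rewrite det_mulmx det_diag (bigD1 ord_max) //= big1 ?mulr1.
    by rewrite mxE eqxx mulrV // -unitmxE.
  by move=> j /negPf neq_j; rewrite mxE neq_j.
rewrite mul_mx_diag; apply/rowP=> j; rewrite !mxE.
by case: (j =P 0) => [-> | _]; rewrite ?mulr1 ?mul0r.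
Qed.

(** The row is lifted to the integers because there the Smith normal form
    provides the elimination; for a single row it has at most one nonzero
    entry, and its left factor is a scalar absorbed into c. *)
Lemma int_row_unimodular m (a : 'rV[int]_m.+1) :
  exists2 A : 'M[int]_m.+1, A \in unitmx &
    exists c : int, a *m A = c *: delta_mx 0 0.
Proof.
have [L _ [R uR [d _ ->]]] := int_Smith_normal_form a.
exists (invmx R); first by rewrite unitmx_inv.
rewrite mulmxK //; exists (L 0 0 * d`_0); apply/rowP=> j.
rewrite !mxE big_ord1 !mxE /= eq_sym.
rewrite -[RHS]mulrA mulr_natr (ord1 ord0).
by congr (_ * (_ *+ nat_of_bool _)).
Qed.

(** An element of Z/n and its gcd g with n divide each other modulo n; these
    are the two coefficients needed to trade one for the other. *)
Lemma Bezout_Zp n (c : int) : (1 < n)%N ->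
  exists g : nat, exists u v : 'Z_n,
    [/\ (g %| n)%N, u * c%:~R = g%:R & v * g%:R = c%:~R].
Proof.
move=> n_gt1; have [u [v uvE]] := Bezoutz c n%:Z.
exists `|gcdz c n|%N.
have gE : (`|gcdz c n|%N%:Z = gcdz c n) by [].
have /dvdzP[q qE] := dvdz_gcdl c n.
exists u%:~R, q%:~R; split.
- by rewrite dvdn_gcdr.
- rewrite -[RHS]/(`|gcdz c n|%N%:Z%:~R) gE -uvE intrD !intrM.
  by rewrite -[n%:~R]/(n%:R) pchar_Zp // mulr0 addr0.
by rewrite -[X in _ * X]/(`|gcdz c n|%N%:Z%:~R) gE -intrM -qE.
Qed.

Lemma last_rowE (R : pzRingType) m (c : R) :
  last_row m.+1 c = c *: delta_mx 0 ord_max.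
Proof.
apply/rowP=> j; rewrite !mxE eqxx /= eqSS -val_eqE /=.
by case: eqP; rewrite ?mulr1 ?mulr0.
Qed.

(** This is where m >= 2 is essential: for m = 1 the group is trivial. *)
Lemma orbit_last_row m n (a : 'rV['Z_n]_m) : (1 < m)%N -> (1 < n)%N ->
  exists2 g : nat, (g %| n)%N &
    last_row m (g%:R : 'Z_n) \in orbit (SL_action m 'Z_n) [set: SL m 'Z_n] a.
Proof.
case: m a => [|[|m]] // a _ n_gt1.
have [A uA [c aA]] := int_row_unimodular (\row_j (a 0 j : nat)%:Z).
pose f : {rmorphism int -> 'Z_n} := intr.
have aAf : a *m map_mx f A = c%:~R *: delta_mx 0 0.
  have -> : a = map_mx f (\row_j (a 0 j : nat)%:Z).
    by apply/rowP=> j; rewrite !mxE /= [RHS](natr_Zp (a 0 j)).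
  by rewrite -map_mxM aA map_mxZ map_delta_mx.
have [|B [detAB e0B]] := @unitmx_correct_det _ _ (map_mx f A).
  by rewrite unitmxE det_map_mx rmorph_unit -?unitmxE.
(* The row is now c e_0; adding u times the first column to the last gives
   c e_0 + g e_max, and subtracting v times the last column from the first
   cancels c = v g. *)
have [g [u [v [dvd_gn ucE vgE]]]] := Bezout_Zp c n_gt1.
have neq_max : (ord_max : 'I_m.+2) != 0 by [].
exists g => //; apply/orbitP.
pose T := (map_mx f A *m B) *m
  (transvection 0 ord_max u *m transvection ord_max 0 (- v)).
have detT : \det T == 1.
  by rewrite !det_mulmx -det_mulmx detAB !det_transvection ?mulr1 // eq_sym.
exists (MkSL detT); first by rewrite inE.
rewrite /= /SLact /= last_rowE !mulmxA aAf -scalemxAl e0B -2!scalemxAl.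
rewrite delta_transvection mulmxDl -scalemxAl delta_transvection.
rewrite delta_transvection_neq 1?eq_sym //.
rewrite !scalerDr !scalerA mulrN [_ * u]mulrC ucE [_ * v]mulrC vgE.
by rewrite scaleNr addrCA subrr addr0.
Qed.

Lemma mem_Or m n d (a : 'rV['Z_n]_m) : (1 < m)%N -> (1 < n)%N -> (d %| n)%N ->
  (a \in Or m n d) = (gcd_row a n == d).
Proof.
move=> m_gt1 n_gt1 dvd_dn; rewrite inE; apply/idP/eqP=> [orb_d | <-].
  by rewrite -(gcd_row_orbit n_gt1 orb_d) gcd_row_last // ltnW.
have [g dvd_gn orb_g] := orbit_last_row a m_gt1 n_gt1.
by rewrite -(gcd_row_orbit n_gt1 orb_g) gcd_row_last // ltnW.
Qed.

(** * Scaling rows, and the Jordan function *)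

Lemma scale_ord_subproof d k N (x : 'I_k) : (0 < d)%N -> N = (d * k)%N ->
  (d * x < N)%N.
Proof. by move=> d_gt0 ->; rewrite ltn_pmul2l. Qed.

(** N is a variable with an equation, rather than d * k itself, because the
    modulus underlying 'Z_n is equal to n only propositionally. *)
Definition scale_row m d k N (d_gt0 : (0 < d)%N) (defN : N = (d * k)%N)
    (b : 'rV['I_k]_m) : 'rV['I_N]_m :=
  map_mx (fun x => Ordinal (scale_ord_subproof x d_gt0 defN)) b.

Lemma scale_row_inj m d k N (d_gt0 : (0 < d)%N) (defN : N = (d * k)%N) :
  injective (@scale_row m d k N d_gt0 defN).
Proof.
move=> b c /rowP eq_bc; apply/rowP=> j; apply: val_inj; apply/eqP.
have /(congr1 val)/eqP := eq_bc j.
by rewrite !mxE /= eqn_pmul2l.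
Qed.

Lemma gcd_scale_row m d k N (d_gt0 : (0 < d)%N) (defN : N = (d * k)%N)
    (b : 'rV['I_k]_m) :
  gcd_row (scale_row d_gt0 defN b) N = (d * gcd_row b k)%N.
Proof.
rewrite /gcd_row muln_gcdr -defN; congr gcdn.
rewrite (big_morph (muln d) (muln_gcdr d) (muln0 d)).
by apply: eq_bigr => j _; rewrite mxE.
Qed.

(** Division by d is the inverse of the scaling.  The predicate P lets the
    same bijection serve both for the points of an orbit and for the sieve. *)
Lemma card_multiple_rows m d k N (d_gt0 : (0 < d)%N) (defN : N = (d * k)%N)
    (P : pred 'rV['I_N]_m) :
  #|[set a : 'rV['I_N]_m | [forall j, d %| a ord0 j]%N && P a]|
    = #|[set b : 'rV['I_k]_m | P (scale_row d_gt0 defN b)]|.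
Proof.
rewrite -(card_imset _ (@scale_row_inj m d k N d_gt0 defN)).
apply: eq_card => a; rewrite inE; apply/andP/imsetP=> [[/forallP dvd_a Pa] | [b]].
  have quo_lt j : (a ord0 j %/ d < k)%N.
    by rewrite ltn_divLR // mulnC -defN.
  have def_a : a = scale_row d_gt0 defN (\row_j Ordinal (quo_lt j)).
    by apply/rowP=> j; apply: val_inj; rewrite !mxE /= mulnC divnK.
  by exists (\row_j Ordinal (quo_lt j)); rewrite // inE -def_a.
rewrite inE => Pb ->; split=> //.
by apply/forallP=> j; rewrite mxE dvdn_mulr.
Qed.

Lemma card_gcd_row m d k N : (0 < d)%N -> N = (d * k)%N ->
  #|[set a : 'rV['I_N]_m | gcd_row a N == d]| = jordan m k.
Proof.
move=> d_gt0 defN.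
have -> : [set a : 'rV['I_N]_m | gcd_row a N == d] =
    [set a : 'rV['I_N]_m | [forall j, d %| a ord0 j]%N && (gcd_row a N == d)].
  apply/setP=> a; rewrite !inE; case: eqP => [def_d | _]; rewrite ?andbF //.
  by have := dvdnn d; rewrite -{2}def_d dvdn_gcd_row => /andP[-> _].
rewrite (card_multiple_rows d_gt0 defN); apply: eq_card => b.
by rewrite !inE gcd_scale_row -{2}[d]muln1 eqn_pmul2l.
Qed.

Definition rows_avoiding m k (s : seq nat) : {set 'rV['I_k]_m} :=
  [set a : 'rV['I_k]_m | all (fun p => ~~ [forall j, p %| a ord0 j]%N) s].

(** A gcd different from 1 has a prime factor, which then also divides k. *)
Lemma jordan_rows_avoiding m k : (0 < k)%N ->
  jordan m k = #|rows_avoiding m k (primes k)|.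
Proof.
move=> k_gt0; apply: eq_card => a; rewrite !inE.
have g_gt0 : (0 < gcd_row a k)%N by rewrite gcdn_gt0 k_gt0 orbT.
apply/eqP/allP => [g1 p | no_p].
  rewrite mem_primes => /and3P[p_pr _ dvd_pk]; apply/negP=> dvd_pa.
  have : (p %| gcd_row a k)%N by rewrite dvdn_gcd_row dvd_pa.
  by rewrite g1 dvdn1 => /eqP p1; rewrite p1 in p_pr.
apply/eqP; rewrite eqn_leq g_gt0 andbT leqNgt; apply/negP=> /pdivP[p p_pr].
rewrite dvdn_gcd_row => /andP[dvd_pa dvd_pk].
by apply: (negP (no_p p _)) dvd_pa; rewrite mem_primes p_pr k_gt0.
Qed.

(** Sieve by induction on s, with k varying: the rows modulo k that avoid s
    and are divisible by p are the multiples by p of the rows modulo k / p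
    that avoid s, because the primes of s differ from p. In the same way, the
    primes of s still divide k / p, so the induction hypothesis applies. *)
Lemma card_rows_avoiding m k (s : seq nat) : (0 < k)%N -> uniq s ->
  all (fun p => prime p && (p %| k)%N) s ->
  (#|rows_avoiding m k s|%:R : rat)
    = k%:R ^+ m * \prod_(p <- s) (1 - p%:R ^- m).
Proof.
elim: s k => [|p s IHs] k k_gt0 /=.
  move=> _ _; rewrite big_nil mulr1 -natrX; congr _%:R.
  rewrite -[RHS](_ : #|'rV['I_k]_m| = _); last by rewrite card_mx card_ord mul1n.
  by apply: eq_card => a; rewrite inE.
case/andP=> p_s uniq_s /andP[/andP[p_pr dvd_pk] s_pr].
have p_gt0 := prime_gt0 p_pr.
have defk : k = (p * (k %/ p))%N by rewrite mulnC divnK.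
have l_gt0 : (0 < k %/ p)%N by rewrite divn_gt0 // dvdn_leq.
have dvd_q q : q \in s -> forall x, (q %| p * x)%N = (q %| x)%N.
  move=> q_s x; have /andP[q_pr _] := allP s_pr q q_s.
  apply: Gauss_dvdr; rewrite prime_coprime // dvdn_prime2 //.
  by apply: contraNneq p_s => <-.
have s_pr_l : all (fun q => prime q && (q %| k %/ p)%N) s.
  apply/allP=> q q_s; have /andP[-> dvd_qk] := allP s_pr q q_s.
  by rewrite -(dvd_q q) // -defk.
have cardE : (#|rows_avoiding m k (p :: s)| + #|rows_avoiding m (k %/ p) s|
               = #|rows_avoiding m k s|)%N.
  pose D := [set a : 'rV['I_k]_m | [forall j, p %| a ord0 j]%N].
  rewrite -[RHS](cardsID D) addnC; congr addn.
    rewrite -[RHS](_ : #|[set a : 'rV['I_k]_m |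
      [forall j, p %| a ord0 j]%N && (a \in rows_avoiding m k s)]| = _);
      last first.
      by apply: eq_card => a; rewrite !inE andbC.
    rewrite (card_multiple_rows p_gt0 defk); apply: eq_card => b; rewrite !inE.
    apply: eq_in_all => q q_s; congr negb; apply: eq_forallb => j.
    by rewrite mxE /= dvd_q.
  by apply: eq_card => a; rewrite !inE.
move/(congr1 (fun x => x%:R : rat)): cardE; rewrite natrD !IHs //.
move/(canRL (addrK _)) ->; rewrite big_cons -mulrBl mulrA; congr (_ * _).
have p_neq0 : (p%:R : rat) != 0 by rewrite Num.Theory.pnatr_eq0 -lt0n.
by rewrite {1 3}defk natrM exprMn mulrBr mulr1 mulrAC mulfV ?mul1r // expf_neq0.
Qed.

Lemma jordan_prod m k : (0 < k)%N ->
  ((jordan m k)%:R : rat) = k%:R ^+ m * \prod_(p <- primes k) (1 - p%:R ^- m).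
Proof.
move=> k_gt0; rewrite jordan_rows_avoiding // card_rows_avoiding ?primes_uniq //.
by apply/allP=> p; rewrite mem_primes => /and3P[-> _].
Qed.

Lemma primes_div n d : (0 < n)%N -> (d %| n)%N ->
  perm_eq (primes (n %/ d))
    [seq p <- index_iota 1 n.+1 | prime p && (p * d %| n)%N].
Proof.
move=> n_gt0 dvd_dn; have d_gt0 := dvdn_gt0 n_gt0 dvd_dn.
apply: uniq_perm; rewrite ?primes_uniq ?filter_uniq ?iota_uniq // => p.
rewrite mem_filter mem_primes mem_index_iota divn_gt0 // dvdn_leq //=.
rewrite dvdn_divRL // ltnS.
apply/andP/andP=> [[p_pr dvd_p] | [/andP[-> ->]] //].
rewrite p_pr dvd_p prime_gt0 // dvdn_leq //.
exact: dvdn_trans (dvdn_mulr _ _) dvd_p.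
Qed.

(** * The orbits of SL(m, Z/n) *)

Theorem theorem4p9 (m n : nat) (hm : (2 <= m)%N) (hn : (2 <= n)%N) :
  ((forall a : 'rV['Z_n]_m,
      exists d : nat,
        (d %| n)%N /\
        orbit (SL_action m 'Z_n) [set: SL m 'Z_n] a = Or m n d) /\
   [set: 'rV['Z_n]_m] = \bigcup_(d <- divisors n) Or m n d) /\
  (forall d : nat, (d %| n)%N ->
      Or m n d = [set a : 'rV['Z_n]_m | gcd_row a n == d]) /\
  (forall d : nat, (d %| n)%N ->
      #|Or m n d| = jordan m (n %/ d)%N /\
      (jordan m (n %/ d)%N)%:R =
        ((n %/ d)%N%:R : rat) ^+ m *
          \prod_(1 <= p < n.+1 | prime p && (p * d %| n)%N)
            (1 - (p%:R : rat) ^- m)).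
Proof.
have n_gt0 : (0 < n)%N := ltnW hn.
have gcd_dvd (a : 'rV['Z_n]_m) : (gcd_row a n %| n)%N by apply: dvdn_gcdr.
have OrE d : (d %| n)%N -> Or m n d = [set a : 'rV['Z_n]_m | gcd_row a n == d].
  by move=> dvd_dn; apply/setP=> a; rewrite mem_Or // inE.
split; [split | split=> // d dvd_dn].
- move=> a; exists (gcd_row a n); split=> //; apply/setP=> b.
  have : a \in Or m n (gcd_row a n) by rewrite mem_Or.
  rewrite !inE orbit_sym => orb_a.
  by rewrite (orbit_eqP orb_a) orbit_sym.
- apply/setP=> a; rewrite (big_rem (gcd_row a n)) -?dvdn_divisors //=.
  by rewrite !in_setU in_setT mem_Or // eqxx.
have d_gt0 := dvdn_gt0 n_gt0 dvd_dn.
have l_gt0 : (0 < n %/ d)%N by rewrite divn_gt0 // dvdn_leq.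
split.
  have defN : (Zp_trunc n).+2 = (d * (n %/ d))%N.
    by rewrite Zp_cast // mulnC divnK.
  rewrite OrE // -(@card_gcd_row m d _ _ d_gt0 defN); apply: eq_card => a.
  by rewrite !inE [in RHS]/gcd_row [X in gcdn _ X]Zp_cast.
by rewrite jordan_prod // (perm_big _ (primes_div n_gt0 dvd_dn)) big_filter.
Qed.
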